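(* Let $\mathcal{I},\mathcal{J}$ be ideals on $\omega$. Then the following hold: (i) if $\mathcal{I}\le_{\mathrm{RK}}\mathcal{J}$ then $\mathscr{H}(\mathcal{I})\subseteq\mathscr{H}(\mathcal{J})$; (ii) if $\mathcal{I}\le_{\mathrm{RB}}\mathcal{J}$ then $\mathscr{H}^\star(\mathcal{I})\subseteq\mathscr{H}^\star(\mathcal{J})$.
   Context: $\omega=\{0,1,2,\dots\}$; $\mathbb{T}=\mathbb{R}/\mathbb{Z}$; $\|x\|:=\min\{|x-z|:z\in\mathbb{Z}\}$. An ideal on $\omega$ is a family $\mathcal{I}\subseteq\mathcal{P}(\omega)$ closed under subsets and finite unions, containing all finite subsets of $\omega$, and with $\omega\notin\mathcal{I}$. For ideals $\mathcal{I},\mathcal{J}$ on $\omega$: $\mathcal{I}\le_{\mathrm{RK}}\mathcal{J}$ (Rudin--Keisler order) if there is $f:\omega\to\omega$ such that for all $A\subseteq\omega$, $f^{-1}[A]\in\mathcal{J}$ if and only if $A\in\mathcal{I}$; $\mathcal{I}\le_{\mathrm{RB}}\mathcal{J}$ (Rudin--Blass order) if in addition such an $f$ can be taken finite-to-one. A sequence $(x_n)$ in $\mathbb{T}$ is $\mathcal{I}$-convergent to $\eta$ if $\{n\in\omega:\|x_n-\eta\|\ge\varepsilon\}\in\mathcal{I}$ for all $\varepsilon>0$; it is $\mathcal{I}^\star$-convergent to $\eta$ if there is $S\in\mathcal{I}$ such that $(x_n:n\in\omega\setminus S)$ converges to $\eta$ in the ordinary sense. For $\boldsymbol{a}=(a_n:n\in\omega)\in\mathbb{Z}^\omega$,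 $\mathsf{H}_{\boldsymbol{a}}(\mathcal{I}):=\{x\in\mathbb{T}:\mathcal{I}\text{-}\lim_n a_nx=0\}$ and $\mathsf{H}^\star_{\boldsymbol{a}}(\mathcal{I}):=\{x\in\mathbb{T}:\mathcal{I}^\star\text{-}\lim_n a_nx=0\}$. Finally, $\mathscr{H}(\mathcal{I}):=\{\mathsf{H}_{\boldsymbol{a}}(\mathcal{I}):\boldsymbol{a}\in\mathbb{Z}^\omega\}$ and $\mathscr{H}^\star(\mathcal{I}):=\{\mathsf{H}^\star_{\boldsymbol{a}}(\mathcal{I}):\boldsymbol{a}\in\mathbb{Z}^\omega\}$. *)

(* Defs.v *)
From HB Require Import structures.
From mathcomp Require Import all_boot all_order all_algebra.
From mathcomp Require Import generic_quotient ring_quotient.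
From mathcomp Require Import all_classical all_reals.
From mathcomp Require Import topology normedtype sequences.

Set Implicit Arguments.
Unset Strict Implicit.
Unset Printing Implicit Defensive.

Import Order.TTheory GRing.Theory Num.Theory.
Import numFieldNormedType.Exports.

Local Open Scope classical_set_scope.
Local Open Scope ring_scope.
Local Open Scope quotient_scope.

(* Closure under finite unions includes the empty union: set0 is covered by
   the finite sets. *)
Definition is_ideal (I : set_system nat) : Prop :=
  [/\ forall A B, A `<=` B -> I B -> I A,
      forall A B, I A -> I B -> I (A `|` B),
      forall A, finite_set A -> I A
    & ~ I setT].

Definition rk_reduction (I J : set_system nat) (f : nat -> nat) : Prop :=
  forall A, J (f @^-1` A) <-> I A.

Definition finite_to_one (f : nat -> nat) : Prop :=
  forall n, finite_set (f @^-1` [set n]).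

Definition RK_le (I J : set_system nat) : Prop :=
  exists f, rk_reduction I J f.

Definition RB_le (I J : set_system nat) : Prop :=
  exists2 f, finite_to_one f & rk_reduction I J f.

Definition Zsub (R : realType) : {pred R} := fun x => x \is a Num.int.

Fact Zsub_zmod_closed (R : realType) : zmod_closed (@Zsub R).
Proof. by split=> [|x y]; [exact: rpred0 | exact: rpredB]. Qed.

HB.instance Definition _ (R : realType) :=
  GRing.isZmodClosed.Build R (@Zsub R) (@Zsub_zmod_closed R).

Definition torus (R : realType) : zmodType := Quotient.quot (@Zsub R).

Definition dist_int (R : realType) (r : R) : R :=
  inf [set `|r - z%:~R| | z in [set: int]].

(* The infimum is a minimum. *)
Lemma dist_int_min (R : realType) (r : R) :
  (exists z : int, dist_int r = `|r - z%:~R|) /\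
  (forall z : int, dist_int r <= `|r - z%:~R|).
Proof.
set S := [set `|r - z%:~R| | z in [set: int]].
have S0 : lbound S 0 by move=> _ [z _ <-]; exact: normr_ge0.
have le_S (z : int) : dist_int r <= `|r - z%:~R|.
  by apply: ge_inf; [exists 0 | exists z].
split=> //.
have key (m : int) : (forall z : int, `|r - m%:~R| <= `|r - z%:~R|) ->
    exists z : int, dist_int r = `|r - z%:~R|.
  move=> hm; exists m; apply/eqP; rewrite eq_le le_S /=.
  by apply: lb_le_inf; [exists `|r - m%:~R|; exists m | move=> _ [z _ <-]].
set f := Num.floor r.
have fr : f%:~R <= r by exact: floor_le.
have rf : r < (f + 1)%:~R by exact: floorD1_gt.
have below (z : int) : z <= f -> `|r - f%:~R| <= `|r - z%:~R|.
  move=> zf; have zfR : z%:~R <= f%:~R :> R by rewrite ler_int.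
  by rewrite !ger0_norm ?subr_ge0 ?lerB // (le_trans zfR).
have above (z : int) : f < z -> `|r - (f + 1)%:~R| <= `|r - z%:~R|.
  rewrite -lezD1 => fz; have fzR : (f + 1)%:~R <= z%:~R :> R by rewrite ler_int.
  rewrite !(distrC r) !ger0_norm ?subr_ge0 ?lerD2r //; last exact: ltW.
  by rewrite (le_trans (ltW rf)).
have [h|/ltW h] := leP `|r - f%:~R| `|r - (f + 1)%:~R|.
- apply: (key f) => z; have [/below//|/above] := leP z f.
  exact: le_trans.
- apply: (key (f + 1)) => z; have [/below|/above//] := leP z f.
  exact: le_trans.
Qed.

Lemma dist_intDz (R : realType) (r : R) (k : int) :
  dist_int (r + k%:~R) = dist_int r.
Proof.
rewrite /dist_int; congr inf; apply/seteqP; split=> _ [z _ <-].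
  by exists (z - k) => //; rewrite intrB opprB addrCA addrA [_ + r]addrC addrAC.
by exists (z + k) => //; rewrite intrD opprD addrACA subrr addr0.
Qed.

Definition torus_norm (R : realType) (x : torus R) : R := dist_int (repr x).

Lemma torus_norm_pi (R : realType) (r : R) :
  torus_norm (\pi_(torus R) r) = dist_int r.
Proof.
rewrite /torus_norm; set s := repr _.
have : s == r %[mod torus R] by rewrite /s reprK.
rewrite -Quotient.idealrBE => /intrP[k srk].
by rewrite -[s](subrK r) srk addrC dist_intDz.
Qed.

Definition ideal_cvg (R : realType) (I : set_system nat)
    (x : nat -> torus R) (eta : torus R) : Prop :=
  forall eps : R, 0 < eps -> I [set n | eps <= torus_norm (x n - eta)].

Definition ideal_star_cvg (R : realType) (I : set_system nat)
    (x : nat -> torus R) (eta : torus R) : Prop :=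
  exists2 S, I S &
    torus_norm (x n - eta) @[n --> within (~` S) \oo] --> (0 : R).

Definition Ha (R : realType) (a : nat -> int) (I : set_system nat) :
    set (torus R) :=
  [set x | ideal_cvg I (fun n => x *~ a n) 0].

Definition Hastar (R : realType) (a : nat -> int) (I : set_system nat) :
    set (torus R) :=
  [set x | ideal_star_cvg I (fun n => x *~ a n) 0].

Definition scrH (R : realType) (I : set_system nat) : set (set (torus R)) :=
  [set Ha a I | a in [set: nat -> int]].

Definition scrHstar (R : realType) (I : set_system nat) :
    set (set (torus R)) :=
  [set Hastar a I | a in [set: nat -> int]].

Arguments scrH : clear implicits.
Arguments scrHstar : clear implicits.

(* Main.v *)
Require Import Defs.
From mathcomp Require Import all_boot all_order all_algebra.
From mathcomp Require Import all_classical all_reals.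
From mathcomp Require Import topology normedtype sequences.

(** Let [f] reduce [I] to [J]. Precomposition with [f] preserves each subgroup:
    for every integer sequence [a], the subgroup attached to [a] by [I] is the
    one attached to [a \o f] by [J].

    For ideal convergence this is the defining property of a Rudin-Keisler
    reduction, because the set of indices [n] at which the multiple of [x] by
    [a (f n)] is far from zero is the [f]-preimage of the corresponding set for
    [a].

    For star convergence, express convergence off an exceptional set by the
    finiteness of the sets of large values ([cvg_within_setCP]). An exceptional
    set [S] for [a] pulls back to [f @^-1` S], and the finite sets of large
    values stay finite under preimage because [f] is finite-to-one. Conversely,
    given an exceptional set [T] for [a \o f], discard exactly the points whose
    whole fiber lies in [T]: the preimage of the discarded set is contained in
    [T], and a large value at a point kept is also a large value at some point
    of its fiber off [T] ([ideal_star_cvg_comp]). *)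

Import Order.TTheory GRing.Theory Num.Theory.
Import numFieldNormedType.Exports.

Local Open Scope classical_set_scope.

Lemma finite_to_one_preimage (f : nat -> nat) (A : set nat) :
  finite_to_one f -> finite_set A -> finite_set (f @^-1` A).
Proof.
move=> ff fA.
suff -> : f @^-1` A = \bigcup_(m in A) f @^-1` [set m].
  by apply: bigcup_finite => // m _; exact: ff.
by apply/seteqP; split=> [n An|n [m Am fnm]] /=; [exists (f n) | rewrite fnm].
Qed.

Lemma near_infty_cofiniteP (P : set nat) :
  (\forall n \near \oo, P n) <-> cofinite_set P.
Proof.
split=> [[N _ NP]|/finite_seqP[s sE]].
  apply: (sub_finite_set _ (finite_II N)) => n /= nP.
  by rewrite ltnNge; apply/negP => /NP.
exists (\max_(i <- s) i).+1 => // n /= sn.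
apply: contrapT => nP; have : (~` P) n by [].
by rewrite sE /= => ns; move: sn; rewrite /= ltnNge leq_bigmax_seq.
Qed.

(** A neighbourhood-free form of convergence off [S], which transports along
    maps of indices by images and preimages of finite sets. *)
Lemma cvg_within_setCP (R : realFieldType) (V : pseudoMetricNormedZmodType R)
    (S : set nat) (g : nat -> V) :
  (g n @[n --> within (~` S) \oo] --> (0 : V)%R) <->
  forall eps : R, (0 < eps)%R ->
    finite_set (~` S `&` [set n | (eps <= `|g n|)%R]).
Proof.
have E eps : ~` S `&` [set n | (eps <= `|g n|)%R] =
    ~` [set n | (~` S) n -> (`|g n| < eps)%R].
  apply/seteqP; split=> n /=.
    by move=> [Sn egn] /(_ Sn); rewrite ltNge egn.
  by move=> /not_implyP[Sn /negP]; rewrite -leNgt.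
split=> [/cvgr0Pnorm_lt gS eps /gS|gS].
  by rewrite near_withinE E => /near_infty_cofiniteP.
apply/cvgr0Pnorm_lt => eps /gS.
by rewrite near_withinE E => /near_infty_cofiniteP.
Qed.

Lemma ideal_cvg_comp (R : realType) (I J : set_system nat) (f : nat -> nat)
    (x : nat -> torus R) (eta : torus R) :
  rk_reduction I J f -> ideal_cvg J (x \o f) eta <-> ideal_cvg I x eta.
Proof.
move=> fIJ; split=> xeta eps eps0; first by apply/fIJ; exact: xeta.
by apply: (proj2 (fIJ [set n | (eps <= torus_norm (x n - eta))%R])); exact: xeta.
Qed.

(** From left to right, the exceptional set for [x] consists of the points whose
    fiber lies in [T], rather than of the image of [T]: the preimage of that
    image may fail to be in [J], and [x] is arbitrary at points outside the
    range of [f], which have an empty fiber. *)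
Lemma ideal_star_cvg_comp (R : realType) (I J : set_system nat)
    (f : nat -> nat) (x : nat -> torus R) (eta : torus R) :
  is_ideal J -> finite_to_one f -> rk_reduction I J f ->
  ideal_star_cvg J (x \o f) eta <-> ideal_star_cvg I x eta.
Proof.
move=> [subJ _ _ _] ff fIJ; split=> -[].
- move=> T JT /cvg_within_setCP cT.
  exists [set m | f @^-1` [set m] `<=` T].
    by apply/fIJ; apply: subJ JT => n; exact.
  apply/cvg_within_setCP => eps /cT /(finite_image f); apply: sub_finite_set.
  by move=> m [/= /existsNP[n /not_implyP[<- nT]] le_eps]; exists n.
- move=> S IS /cvg_within_setCP cS; exists (f @^-1` S); first exact/fIJ.
  by apply/cvg_within_setCP => eps /cS /(finite_to_one_preimage _ _ ff).
Qed.

Theorem theorem2p6 (R : realType) (I J : set_system nat)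
    (hI : is_ideal I) (hJ : is_ideal J) :
  (RK_le I J -> scrH R I `<=` scrH R J) /\
  (RB_le I J -> scrHstar R I `<=` scrHstar R J).
Proof.
split=> [[f fIJ]|[f ff fIJ]] _ [a _ <-]; exists (a \o f) => //.
- by apply/seteqP; split=> x
    /(ideal_cvg_comp _ _ _ _ (fun n => x *~ a n)%R _ fIJ).
- by apply/seteqP; split=> x
    /(ideal_star_cvg_comp _ _ _ _ (fun n => x *~ a n)%R _ hJ ff fIJ).
Qed.
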